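(* Let $n\ge2$, $1\le k<n$, $u,w\in S_n$ and $\alpha\in\mathbb{N}^{n-1}$ be such that $u<_k^q q^\alpha w$ in the quantum $k$-Bruhat order. Then there are isomorphisms of posets $$[u,q^\alpha w]_k^q\ \simeq\ [\mathfrak{o}u,\ q^{\mathfrak{o}(u,w)}q^\alpha\,\mathfrak{o}w]_k^q\ \simeq\ [w_0uw_0,\ q^{w_0(\alpha)}w_0ww_0]_{n-k}^q\ \simeq\ \mathrm{op}\big([ww_0,\ q^{w_0(\alpha)}uw_0]_{n-k}^q\big)\,.$$
   Context: Permutations are composed as functions, $(i,j)$ is a transposition, $\mathbb{N}=\{0,1,2,\dots\}$, $\ell(u)=\#\{i<j\mid u(i)>u(j)\}$. $q^\alpha=q_1^{\alpha_1}\cdots q_{n-1}^{\alpha_{n-1}}$; $q_{i,j}=q_iq_{i+1}\cdots q_{j-1}$ for $i<j$, $q_{i,i}=1$, and $q_{i,j}=q_{j,i}^{-1}$ for $i>j$ (a Laurent monomial). Quantum $k$-Bruhat order $\le_k^q$ on $S_n[q]=\{q^\alpha u\mid u\in S_n,\ \alpha\in\mathbb{N}^{n-1}\}$: the partial order generated by the covers $u\lessdot_k^q u(i,j)$ if $i\le k<j$ and $\ell(u(i,j))=\ell(u)+1$; $u\lessdot_k^q q_{i,j}u(i,j)$ if $i\le k<j$ and $\ell(u)+1=\ell(u(i,j))+2(j-i)$; and extended $q$-multiplicatively ($q^\alpha u\le^q_k q^{\alpha+\beta}w$ iff $u\le_k^q q^\beta w$). For $u\le_k^q q^\alpha w$,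 $[u,q^\alpha w]_k^q$ denotes the interval in this order. $\mathfrak{o}=(1,2,\dots,n)$ is the $n$-cycle and $\mathfrak{o}u$ is the product of $\mathfrak{o}$ and $u$ (so $(\mathfrak{o}u)(i)=\mathfrak{o}(u(i))$). $w_0\in S_n$ is the longest element, $w_0(i)=n+1-i$. $q^{w_0(\alpha)}=q_1^{\alpha_{n-1}}\cdots q_{n-1}^{\alpha_1}$. $q^{\mathfrak{o}(u,w)}=q_{w^{-1}(n),u^{-1}(n)}$. $\mathrm{op}(P)$ is the opposite poset of $P$. *)

(* Defs.v *)
From Stdlib Require Import Relation_Definitions Relation_Operators.
From mathcomp Require Import all_boot all_fingroup all_algebra.
From mathcomp Require Import classical_sets functions.

Set Implicit Arguments.
Unset Strict Implicit.
Unset Printing Implicit Defensive.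

Import GRing.Theory.

(* Everything is 0-based: the index [i] of the paper's {1,...,n} is the ordinal
   of value [i - 1] in ['I_n], and q_a is the ordinal of value [a - 1] in
   ['I_n.-1]. *)

(* MathComp multiplies permutations from left to right; [u \c v] is composition
   of functions, (u \c v) i = u (v i). *)
Definition perm_comp n (u v : 'S_n) : 'S_n := (v * u)%g.
Notation "u '\c' v" := (perm_comp u v) (at level 40, left associativity).

Definition perm_len n (u : 'S_n) : nat :=
  #|[set p : 'I_n * 'I_n | (p.1 < p.2) && (u p.2 < u p.1)]|.

Definition perm_o n : 'S_n := perm (@ordS_inj n).

Definition perm_w0 n : 'S_n := perm (@rev_ord_inj n).

(* Exponents of the monomials, resp. Laurent monomials, in q_1, ..., q_(n-1);
   the product of monomials is the sum of exponents. *)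
Definition qexp (n : nat) := {ffun 'I_n.-1 -> nat}.
Definition qlexp (n : nat) := {ffun 'I_n.-1 -> int}.

Definition qlexp_of n (a : qexp n) : qlexp n := [ffun c => Posz (a c)].

(* q_{i,j} = q_i q_(i+1) ... q_(j-1), for i <= j. *)
Definition qij n (i j : 'I_n) : qexp n := [ffun c : 'I_n.-1 => (i <= c < j : nat)].

(* q_{i,j} for arbitrary i and j, with q_{i,j} = q_{j,i}^-1 when j < i. *)
Definition qlij n (i j : 'I_n) : qlexp n :=
  if i <= j then qlexp_of (qij i j) else (- qlexp_of (qij j i))%R.

Definition qexp_w0 n (a : qexp n) : qexp n := [ffun c => a (rev_ord c)].

Definition ord_last n (n_gt0 : 0 < n) : 'I_n := rev_ord (Ordinal n_gt0).

(* The exponent of q^{o(u,w)}. *)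
Definition qlexp_o n (n_gt0 : 0 < n) (u w : 'S_n) : qlexp n :=
  qlij ((w^-1)%g (ord_last n_gt0)) ((u^-1)%g (ord_last n_gt0)).

(* S_n[q]; the element q^a u is the pair (a, u). *)
Definition qperm (n : nat) := (qexp n * 'S_n)%type.

Definition qperm1 n (u : 'S_n) : qperm n := (0%R, u).

(* The covers of the quantum k-Bruhat order, multiplied by an arbitrary
   monomial. The condition i <= k < j reads i < k <= j for 0-based i and j. *)
Definition qcover n (k : nat) : relation (qperm n) := fun x y =>
  exists i j : 'I_n,
    [/\ i < k <= j,
        y.2 = x.2 \c tperm i j
      & (perm_len y.2 = (perm_len x.2).+1 /\ y.1 = x.1) \/
        ((perm_len x.2).+1 = perm_len y.2 + 2 * (j - i) /\
         y.1 = (x.1 + qij i j)%R)].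

Definition qle n (k : nat) : relation (qperm n) :=
  clos_refl_trans (qperm n) (qcover k).

Definition qlt n (k : nat) : relation (qperm n) := fun x y =>
  qle k x y /\ x <> y.

Definition qrank n (x : qperm n) : nat := perm_len x.2 + 2 * \sum_c x.1 c.

Lemma sum_qij n (i j : 'I_n) : i <= j -> \sum_c qij i j c = j - i.
Proof.
case: n i j => [[]//|n] i j le_ij.
under eq_bigr do rewrite ffunE.
rewrite -[LHS]big_mkcond /= -(big_mkord (fun c => i <= c < j) (fun=> 1)).
rewrite (big_cat_nat _ (n := j)) //=; last by rewrite -ltnS.
rewrite (big_cat_nat _ (n := i)) //=.
rewrite big_nat_cond big1 ?add0n; last first.
  by move=> c /andP[/andP[_ ci]] /andP[]; rewrite leqNgt ci.
rewrite [X in _ + X]big_nat_cond [X in _ + X]big1 ?addn0; last first.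
  by move=> c /andP[/andP[jc _]] /andP[_]; rewrite ltnNge jc.
rewrite big_nat_cond (eq_bigl (fun c => (i <= c < j) && true)); last first.
  by move=> c; rewrite andbT andbb.
by rewrite -big_nat_cond sum_nat_const_nat muln1.
Qed.

Lemma qcover_rank n k (x y : qperm n) : qcover k x y -> qrank y = (qrank x).+1.
Proof.
rewrite /qrank => -[i [j [/andP[ik kj] _ [[lxy ->]|[lxy ->]]]]].
  by rewrite lxy addSn.
under eq_bigr do rewrite ffunE.
rewrite big_split /= sum_qij; last exact: (leq_trans (ltnW ik)).
by rewrite mulnDr addnCA -lxy addnS addnC.
Qed.

Lemma qle_rank n k (x y : qperm n) : qle k x y -> x = y \/ qrank x < qrank y.
Proof.
elim=> [a b /qcover_rank ->|a|a b c _ [->|ab] _ [<-|bc]]; [|by left| | | |];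
  rewrite ?ltnSn; try by [right | left].
by right; apply: ltn_trans bc.
Qed.

Lemma qle_order n k : Relation_Definitions.order (qperm n) (@qle n k).
Proof.
split=> [x|x y z|x y]; first exact: rt_refl.
  exact: rt_trans.
move=> /qle_rank[//|xy] /qle_rank[//|yx].
by have := ltn_trans xy yx; rewrite ltnn.
Qed.

Lemma qleM n k (a b : qexp n) (u w : 'S_n) :
  qle k (a, u) ((a + b)%R, w) <-> qle k (qperm1 u) (b, w).
Proof.
have divM (x y : qperm n) : qle k x y -> forall c v, x = ((a + c)%R, v) ->
    exists2 d, y.1 = (a + d)%R & qle k (c, v) (d, y.2).
  elim=> {x y} [x y|x|x y z _ IHx _ IHy] => [[i [j [ikj yx xy]]] c v xE|c v ->|].
  - move: xy yx; rewrite {}xE /= => -[[l y1]|[l y1]] y2.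
      by exists c => //; apply: rt_step; exists i, j; split=> //; left.
    exists (c + qij i j)%R; first by rewrite y1 addrA.
    by apply: rt_step; exists i, j; split=> //; right.
  - by exists c => //; exact: rt_refl.
  - move=> c v /IHx[d yE cd].
    have /IHy[e zE de] : y = ((a + d)%R, y.2) by rewrite -yE; case: (y).
    by exists e => //; apply: rt_trans de.
have mulM (x y : qperm n) : qle k x y ->
    qle k ((a + x.1)%R, x.2) ((a + y.1)%R, y.2).
  elim=> {x y} [x y [i [j [ikj yx xy]]]|x|x y z _ xy _ yz]; last 1 first.
  - exact: rt_trans yz.
  - apply: rt_step; exists i, j; split=> //=.
    by case: xy => -[l ->]; [left|right; rewrite addrA].
  - exact: rt_refl.
split=> [/divM/(_ 0%R u)[]|/mulM]; rewrite /= ?addr0 //.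
by move=> d /ffunP abd; suff -> : b = d by []; apply/ffunP => c;
  have /eqP := abd c; rewrite !ffunE eqn_add2l => /eqP.
Qed.

(* A subset of an ordered type, with the induced order. *)
Record poset (T : Type) := Poset {
  pset : set T;
  ple : relation T;
  ple_order : Relation_Definitions.order T ple }.

Definition poset_iso (T U : Type) (P : poset T) (Q : poset U) : Prop :=
  exists f : T -> U, set_bij (pset P) (pset Q) f /\
    forall x y, pset P x -> pset P y -> (ple P x y <-> ple Q (f x) (f y)).
Notation "P '\simeq' Q" := (poset_iso P Q) (at level 70, no associativity).

Lemma flip_order T (r : relation T) : Relation_Definitions.order T r ->
  Relation_Definitions.order T (fun x y => r y x).
Proof.
by case=> rr rt ra; split=> [x|x y z xy yz|x y xy yx];
  [exact: rr|exact: rt xy|exact: ra].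
Qed.

Definition op_poset T (P : poset T) : poset T :=
  Poset (pset P) (flip_order (ple_order P)).

Definition qinterval n (k : nat) (x y : qperm n) : poset (qperm n) :=
  Poset [set z | qle k x z /\ qle k z y]%classic (@qle_order n k).

(* Main.v *)
Require Import Defs.
From Stdlib Require Import Relation_Definitions Relation_Operators.
From mathcomp Require Import classical_sets.
From mathcomp Require Import all_boot all_fingroup all_algebra.
From mathcomp Require Import zify.

Set Implicit Arguments.
Unset Strict Implicit.
Unset Printing Implicit Defensive.

Import GRing.Theory.

(** All three isomorphisms come from bijections of the whole set of pairs
    (Laurent monomial, permutation) that respect, or reverse, the covers of
    the quantum k-Bruhat order. Laurent exponents are harmless: covers
    multiply by genuine monomials, so everything above an element without
    denominators has no denominators either ([qlle_of]). This also shows that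
    the product of [q^{o(u,w)}] and [q^a] is a genuine monomial: it is the
    exponent of the image of [q^a w], which lies above the image of [u].

    For the long cycle, the map sends [q^g v] to [q_{p,r} q^g o v], where [p]
    is the position of the maximal value in [v] and [r] its position in [u],
    so that [u] goes to [o u]. Moving the maximum to the bottom changes the
    length by [2 p - (n - 1)], counting positions from 0 ([perm_len_o]). Hence
    for a swap of two positions [i < j] not moving the maximum the length
    difference is unchanged, and for a swap that moves it the difference
    changes by [2 (j - i)] up or down, which exchanges the classical covers
    (up by 1) with the quantum ones (down by [2 (j - i) - 1]). The factor
    [q_{p,r}] changes by exactly [q_{i,j}] or its inverse, as the exchange
    requires ([qlcover_o]). Both directions use that a swap raises the length
    whenever it creates an inversion ([perm_len_tperm]), which excludes the
    wrong kind of cover.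

    Conjugation by [w_0] preserves length and sends the swap of [i] and [j] to
    that of their mirror images, which turns the condition for [k] into that
    for [n - k] and reverses the monomials ([qlle_conj_w0]). Left
    multiplication by [w_0] complements the length, so together with [q^g ->
    q^{c - g}] it reverses the order ([qlle_w0]); taking [c] to be the
    exponent at the top of the interval exchanges the two ends as stated. *)

(** * Isomorphisms of restricted relations *)

(** Carrying the inverse map makes symmetry and transitivity immediate, and
    leaving out the order axioms lets an order be reversed, or its scalars be
    enlarged, without a new proof of antisymmetry. *)
Definition rel_iso T U (P : T -> Prop) (R : relation T)
    (Q : U -> Prop) (S : relation U) : Prop :=
  exists (f : T -> U) (g : U -> T),
    [/\ forall x, P x -> Q (f x) /\ g (f x) = x,
        forall y, Q y -> P (g y) /\ f (g y) = y,
        forall x y, P x -> P y -> R x y -> S (f x) (f y)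
      & forall x y, Q x -> Q y -> S x y -> R (g x) (g y)].

Lemma rel_iso_sym T U (P : T -> Prop) R (Q : U -> Prop) S :
  rel_iso P R Q S -> rel_iso Q S P R.
Proof. by move=> [f [g [fP gP fR gR]]]; exists g, f. Qed.

Lemma rel_iso_trans T U V (P : T -> Prop) R (Q : U -> Prop) S
    (O : V -> Prop) N :
  rel_iso P R Q S -> rel_iso Q S O N -> rel_iso P R O N.
Proof.
move=> [f [g [fP gQ fR gS]]] [f' [g' [fQ gO fS gN]]].
exists (f' \o f), (g \o g'); split=> /= [x Px|y Oy|x y Px Py xy|x y Ox Oy xy].
- by have [Qx xK] := fP x Px; have [Ox ->] := fQ _ Qx.
- by have [Qy yK] := gO y Oy; have [Py ->] := gQ _ Qy.
- by apply: fS; [exact: (fP x Px).1|exact: (fP y Py).1|exact: fR].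
- by apply: gS; [exact: (gO x Ox).1|exact: (gO y Oy).1|exact: gN].
Qed.

Lemma rel_iso_flip T U (P : T -> Prop) R (Q : U -> Prop) S :
  rel_iso P R Q S -> rel_iso P (fun x y => R y x) Q (fun x y => S y x).
Proof.
move=> [f [g [fP gP fR gR]]]; exists f, g; split=> // x y ? ?.
  exact: fR.
exact: gR.
Qed.

Lemma rel_iso_eqr T U (P : T -> Prop) R (Q Q' : U -> Prop) S :
  (forall y, Q y <-> Q' y) -> rel_iso P R Q S -> rel_iso P R Q' S.
Proof.
move=> QE [f [g [fP gP fR gR]]]; exists f, g; split.
- by move=> x /fP[/QE].
- by move=> y /QE/gP.
- by [].
- by move=> x y /QE Qx /QE; apply: gR.
Qed.

Lemma rel_iso_poset T U (P : poset T) (Q : poset U) :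
  rel_iso (pset P) (@ple _ P) (pset Q) (@ple _ Q) -> P \simeq Q.
Proof.
move=> [f [g [fP gQ fR gS]]]; exists f; split; last first.
  move=> x y Px Py; split=> [|xy]; first exact: fR.
  have [[Qx xK] [Qy yK]] := (fP x Px, fP y Py).
  by rewrite -xK -yK; apply: gS.
split=> [x Px|x y|y Qy]; first exact: (fP x Px).1.
  rewrite !classical_sets.inE => Px Py fxy.
  by rewrite -(fP x Px).2 -(fP y Py).2 fxy.
by have [Py yK] := gQ y Qy; exists (g y).
Qed.

Definition between T (R : relation T) (x y : T) : T -> Prop :=
  fun z => R x z /\ R z y.

Lemma between_iso T U (R : relation T) (S : relation U) (f : T -> U)
    (g : U -> T) (x y : T) :
    cancel f g -> cancel g f ->
    (forall a b, R a b -> S (f a) (f b)) ->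
    (forall a b, S a b -> R (g a) (g b)) ->
  rel_iso (between R x y) R (between S (f x) (f y)) S.
Proof.
move=> fK gK fR gS; exists f, g; split=> [z [xz zy]|z [xz zy]|a b _ _|a b _ _].
- by split; first (split; apply: fR).
- split; last exact: gK.
  by split; [rewrite -(fK x)|rewrite -(fK y)]; apply: gS.
- exact: fR.
- exact: gS.
Qed.

(** * Order maps induced by maps of covers *)

Lemma clos_homo T U (r : relation T) (s : relation U) (f : T -> U) :
    (forall x y, r x y -> s (f x) (f y)) ->
  forall x y, clos_refl_trans T r x y -> clos_refl_trans U s (f x) (f y).
Proof.
move=> rs x y; elim=> {x y} [x y /rs xy|x|x y z _ xy _ yz].
- exact: rt_step.
- exact: rt_refl.
- exact: rt_trans yz.
Qed.

Lemma clos_anti T U (r : relation T) (s : relation U) (f : T -> U) :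
    (forall x y, r x y -> s (f y) (f x)) ->
  forall x y, clos_refl_trans T r x y -> clos_refl_trans U s (f y) (f x).
Proof.
move=> rs x y; elim=> {x y} [x y /rs xy|x|x y z _ xy _ yz].
- exact: rt_step.
- exact: rt_refl.
- exact: rt_trans xy.
Qed.

(** * Permutations and their lengths *)

Lemma perm_compE n (u v : 'S_n) i : (u \c v) i = u (v i).
Proof. exact: permM. Qed.

Lemma perm_compA n (u v w : 'S_n) : u \c (v \c w) = u \c v \c w.
Proof. by rewrite /perm_comp mulgA. Qed.

Lemma perm_w0E n i : perm_w0 n i = rev_ord i.
Proof. by rewrite permE. Qed.

Lemma perm_oE n i : perm_o n i = ordS i.
Proof. by rewrite permE. Qed.

Lemma perm_w0K n : perm_w0 n \c perm_w0 n = 1%g.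
Proof.
by apply/permP=> i; rewrite perm_compE !permE; exact: rev_ordK.
Qed.

Lemma perm_w0_compK n (v : 'S_n) : perm_w0 n \c (perm_w0 n \c v) = v.
Proof. by rewrite perm_compA perm_w0K /perm_comp mulg1. Qed.

Lemma perm_comp_w0K n (v : 'S_n) : v \c perm_w0 n \c perm_w0 n = v.
Proof. by rewrite -perm_compA perm_w0K /perm_comp mul1g. Qed.

Lemma perm_comp_tpermK n (v : 'S_n) i j : v \c tperm i j \c tperm i j = v.
Proof. by rewrite /perm_comp mulgA tperm2 mul1g. Qed.

Lemma tperm_w0 n (i j : 'I_n) :
  tperm i j \c perm_w0 n = perm_w0 n \c tperm (rev_ord j) (rev_ord i).
Proof.
apply/permP=> x; rewrite !perm_compE !perm_w0E.
by rewrite (inj_tperm _ _ _ (@rev_ord_inj n)) !rev_ordK tpermC.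
Qed.

Definition inversions n (v : 'S_n) : {set 'I_n * 'I_n} :=
  [set p : 'I_n * 'I_n | (p.1 < p.2) && (v p.2 < v p.1)].

(** The map [f] applies the transposition to both positions of a pair, unless
    this puts them out of order, in which case it fixes the pair. It is an
    involution on the pairs in increasing order and sends inversions of [v] to
    inversions of [v \c tperm i j]; the inversion [(i, j)] of the latter is
    missed, because [f] fixes it and it is not an inversion of [v]. *)
Lemma perm_len_tperm n (v : 'S_n) (i j : 'I_n) :
  i < j -> v i < v j -> perm_len v < perm_len (v \c tperm i j).
Proof.
move=> ij vij; set t := tperm i j.
pose f (p : 'I_n * 'I_n) := if t p.1 < t p.2 then (t p.1, t p.2) else p.
have fK (p : 'I_n * 'I_n) : p.1 < p.2 -> f (f p) = p.
  move=> p12; rewrite /f; case tp: (t p.1 < t p.2) => /=; last by rewrite tp.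
  by rewrite !tpermK p12 -surjective_pairing.
have fij : f (i, j) = (i, j) by rewrite /f /= tpermL tpermR ltnNge ltnW.
rewrite /perm_len -!/(inversions _) -(card_in_imset (f := f)); last first.
  move=> p q; rewrite !inE => /andP[p12 _] /andP[q12 _] fpq.
  by rewrite -(fK p p12) fpq fK.
apply: proper_card; apply/properP; split; last first.
  exists (i, j); first by rewrite inE /= !perm_compE tpermL tpermR ij vij.
  apply/imsetP => -[p]; rewrite inE => /andP[p12 vp] ijE.
  by move: vp; rewrite -(fK p p12) -ijE fij /= ltnNge ltnW.
(* When t keeps a before b, v \c t has at (t a, t b) the values of v at (a, b).
   Otherwise a = i or b = j, and v i < v j keeps (a, b) inverted. *)
apply/subsetP => _ /imsetP[[a b]] /[!inE] /= /andP[ab vba] ->.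
rewrite /f /=; case: ifP => [tab|] /=; rewrite !perm_compE ?tpermK ?tab //=.
rewrite ab /t => tab; move: tab ab vba.
case: (tpermP i j a) => [->|->|/eqP ai /eqP aj];
  case: (tpermP i j b) => [->|->|/eqP bi /eqP bj] //; lia.
Qed.

(** Left multiplication by the longest element reverses all values, so it
    exchanges inversions and noninversions. *)
Lemma perm_len_w0 n (v : 'S_n) :
  perm_len (perm_w0 n \c v) + perm_len v =
  #|[set p : 'I_n * 'I_n | p.1 < p.2]|.
Proof.
rewrite /perm_len -!/(inversions _) -cardsUI.
rewrite [_ :&: _](_ : _ = set0) ?cards0 ?addn0; last first.
  apply/setP=> p; rewrite !inE !perm_compE !perm_w0E /=; lia.
congr #|pred_of_set _|; apply/setP=> -[a b].
rewrite !inE !perm_compE !perm_w0E /=.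
case: (ltnP a b) => //= ab.
have vab : v a <> v b :> nat.
  by move=> /val_inj/perm_inj abE; rewrite abE ltnn in ab.
have := ltn_ord (v a); have := ltn_ord (v b); lia.
Qed.

Lemma perm_len_w0_conj n (v : 'S_n) :
  perm_len (perm_w0 n \c v \c perm_w0 n) = perm_len v.
Proof.
pose f (p : 'I_n * 'I_n) := (rev_ord p.2, rev_ord p.1).
have fK : involutive f by case=> a b; rewrite /f /= !rev_ordK.
rewrite /perm_len -!/(inversions _) -(card_imset _ (inv_inj fK)).
congr #|pred_of_set _|; apply/setP=> -[a b].
rewrite -[(a, b) in LHS]fK (mem_imset _ _ (inv_inj fK)).
rewrite !inE !perm_compE !perm_w0E !rev_ordK /=.
have := ltn_ord a; have := ltn_ord b.
have := ltn_ord (v a); have := ltn_ord (v b); lia.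
Qed.

Lemma card_ord_lt n m : m <= n -> #|[set i : 'I_n | i < m]| = m.
Proof.
move=> le_mn; rewrite -sum1_card (eq_bigl (fun i : 'I_n => i < m)).
  by rewrite -(big_ord_widen _ (fun=> 1)) // sum_nat_const card_ord muln1.
by move=> i; rewrite inE.
Qed.

Lemma perm_oE_max n (v : 'S_n) (p : 'I_n) : v p = n.-1 :> nat ->
  forall x, (perm_o n \c v) x = (if x == p then 0 else (v x).+1) :> nat.
Proof.
move=> vp x; rewrite perm_compE perm_oE /=.
have n_gt0 : 0 < n by apply: leq_ltn_trans (ltn_ord x).
case: eqVneq => [->|xp]; first by rewrite vp prednK // modnn.
have vxp : v x <> v p :> nat.
  by move=> /val_inj/perm_inj xpE; rewrite xpE eqxx in xp.
rewrite modn_small //; have := ltn_ord (v x); lia.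
Qed.

(** Only the pairs containing [p] change status: before the cycle acts,
    the value at [p] is maximal and is inverted with each of the [n.-1 - p]
    later positions; afterwards it is minimal and is inverted with each of the
    [p] earlier ones. *)
Lemma perm_len_o n (v : 'S_n) (p : 'I_n) : v p = n.-1 :> nat ->
  perm_len (perm_o n \c v) + n.-1 = perm_len v + 2 * p.
Proof.
move=> vp; have oE := perm_oE_max vp.
(* A consists of the inversions that avoid p, common to v and o v. *)
pose A := [set x in inversions v | (x.1 != p) && (x.2 != p)].
have vmax x : v x <= n.-1 by have := ltn_ord (v x); lia.
have vneq (x : 'I_n) : x != p -> v x < n.-1.
  move=> xp; rewrite ltn_neqAle vmax andbT -vp.
  by apply: contra_neq xp => /val_inj/perm_inj.
have vE : perm_len v = #|A| + (n.-1 - p).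
  have <- : #|pair p @: ~: [set b : 'I_n | b < p.+1]| = n.-1 - p.
    rewrite card_imset => [|b c []//]; rewrite cardsCs setCK card_ord.
    by rewrite card_ord_lt //; lia.
  rewrite -cardsUI [_ :&: _](_ : _ = set0) ?cards0 ?addn0; last first.
    apply/setP=> -[a b]; rewrite !inE /=; apply/negP.
    by case/andP=> /and3P[_ /eqP ap _] /imsetP[c _ [/ap]].
  congr #|pred_of_set _|; apply/setP=> -[a b]; rewrite !inE /=.
  apply/idP/idP => [/andP[ab vba]|].
    case: (eqVneq b p) => [bp|bp]; first by rewrite bp vp ltnNge vmax in vba.
    case: (eqVneq a p) => [ap|ap]; last by rewrite ab vba.
    by rewrite andbF /= ap imset_f // !inE -leqNgt -ap.
  case/orP=> [/andP[]//|/imsetP[c]]; rewrite !inE -leqNgt => pc [-> ->].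
  by rewrite pc vp vneq //; apply: contraTneq pc => ->; rewrite ltnn.
have ovE : perm_len (perm_o n \c v) = #|A| + p.
  have <- : #|(pair^~ p) @: [set a : 'I_n | a < p]| = p.
    by rewrite card_imset => [|b c []//]; rewrite card_ord_lt // ltnW.
  rewrite -cardsUI [_ :&: _](_ : _ = set0) ?cards0 ?addn0; last first.
    apply/setP=> -[a b]; rewrite !inE /=; apply/negP.
    by case/andP=> /and3P[_ _ /eqP bp] /imsetP[c _ [_ /bp]].
  congr #|pred_of_set _|; apply/setP=> -[a b]; rewrite !inE /= !oE.
  apply/idP/idP => [/andP[ab]|].
    case: (eqVneq a p) => [ap|ap]; first by rewrite ltn0.
    case: (eqVneq b p) => [bp|bp]; last by rewrite ab ltnS => ->.
    by rewrite andbF /= bp imset_f // inE -bp.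
  case/orP=> [/and3P[/andP[-> vba] /negPf-> /negPf->]//|].
  case/imsetP=> c; rewrite !inE => cp [-> ->]; rewrite cp eqxx.
  by case: eqVneq => // cpE; rewrite cpE ltnn in cp.
have := ltn_ord p; rewrite vE ovE; lia.
Qed.

(** * Laurent exponents *)

(** Negative exponents are allowed so that the exponent shifts used below are
    bijections of the whole set. *)
Definition qlperm n := (qlexp n * 'S_n)%type.

Definition qlcover n (k : nat) : relation (qlperm n) := fun x y =>
  exists i j : 'I_n,
    [/\ i < k <= j,
        y.2 = x.2 \c tperm i j
      & (perm_len y.2 = (perm_len x.2).+1 /\ y.1 = x.1) \/
        ((perm_len x.2).+1 = perm_len y.2 + 2 * (j - i) /\
         y.1 = (x.1 + qlexp_of (qij i j))%R)].

Definition qlle n (k : nat) : relation (qlperm n) :=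
  clos_refl_trans (qlperm n) (qlcover k).

Definition qlperm_of n (x : qperm n) : qlperm n := (qlexp_of x.1, x.2).

Definition qlperm_abs n (x : qlperm n) : qperm n :=
  ([ffun c => absz (x.1 c)], x.2).

Lemma qlperm_ofK n : cancel (@qlperm_of n) (@qlperm_abs n).
Proof.
by move=> [g v]; congr pair; apply/ffunP => c; rewrite !ffunE.
Qed.

Lemma qlexp_ofD n (g h : qexp n) :
  qlexp_of (g + h)%R = (qlexp_of g + qlexp_of h)%R.
Proof. by apply/ffunP => c; rewrite !ffunE. Qed.

Lemma qlexp_of0 n : qlexp_of (0%R : qexp n) = 0%R.
Proof. by apply/ffunP => c; rewrite !ffunE. Qed.

Lemma qle_qlle n k (x y : qperm n) :
  qle k x y -> qlle k (qlperm_of x) (qlperm_of y).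
Proof.
apply: clos_homo => {x y} x y [i [j [ikj yx xy]]]; exists i, j; split=> //=.
by case: xy => -[l ->]; [left|right; rewrite qlexp_ofD].
Qed.

(** Covers only multiply by monomials with nonnegative exponents, so the
    elements above a true monomial are true monomials. Hence an interval whose
    bottom is a true monomial is the same over Laurent exponents. *)
Lemma qlle_of n k (x : qperm n) (z : qlperm n) :
  qlle k (qlperm_of x) z -> exists2 y, z = qlperm_of y & qle k x y.
Proof.
move=> xz; move E : (qlperm_of x) xz => x' xz.
elim: xz x E => {x' z} [x' z x'z|x'|x' y' z _ IHx _ IHy] x.
- case: z x'z => g v [i [j [/= ikj -> xy]]] xE; rewrite -xE /= in xy *.
  case: xy => -[l ->].
    exists (x.1, x.2 \c tperm i j) => //.
    by apply: rt_step; exists i, j; split=> //; left.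
  exists ((x.1 + qij i j)%R, x.2 \c tperm i j).
    by rewrite /qlperm_of qlexp_ofD.
  by apply: rt_step; exists i, j; split=> //; right.
- by move=> <-; exists x => //; exact: rt_refl.
- move=> /IHx[y yE xy]; have [t tE yt] := IHy _ (esym yE).
  by exists t => //; apply: rt_trans yt.
Qed.

Lemma qlle_qle n k (x y : qperm n) :
  qlle k (qlperm_of x) (qlperm_of y) -> qle k x y.
Proof. by case/qlle_of=> z /(can_inj (@qlperm_ofK n)) ->. Qed.

Lemma qinterval_ql n k (x y : qperm n) :
  rel_iso (between (@qle n k) x y) (@qle n k)
    (between (@qlle n k) (qlperm_of x) (qlperm_of y)) (@qlle n k).
Proof.
exists (@qlperm_of n), (@qlperm_abs n); split.
- by move=> z [xz zy]; split; [split; exact: qle_qlle|exact: qlperm_ofK].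
- move=> z [/qlle_of[t -> xt] /qlle_qle ty]; rewrite qlperm_ofK.
  by split; first split.
- by move=> z t _ _; exact: qle_qlle.
- move=> z t [/qlle_of[z' -> _] _] [/qlle_of[t' -> _] _] /qlle_qle.
  by rewrite !qlperm_ofK.
Qed.

(** This formula makes [qlij] a difference of a function of [j] and one of [i],
    which is why it is additive along [i], [j], [l] in any order. *)
Lemma qlijE n (i j : 'I_n) :
  qlij i j = [ffun c : 'I_n.-1 => ((c < j)%N%:Z - (c < i)%N%:Z)%R].
Proof.
apply/ffunP => c; rewrite /qlij !ffunE.
by case: (leqP i j) => ij; rewrite !ffunE; case: ltnP; case: ltnP => //=; lia.
Qed.

Lemma qlijD n (i j l : 'I_n) : (qlij i j + qlij j l = qlij i l)%R.
Proof. by apply/ffunP => c; rewrite !qlijE !ffunE addrC subrKA. Qed.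

Lemma qlij_id n (i : 'I_n) : qlij i i = 0%R.
Proof. by apply/ffunP => c; rewrite qlijE !ffunE subrr. Qed.

Lemma qlexp_of_qij n (i j : 'I_n) : i <= j -> qlexp_of (qij i j) = qlij i j.
Proof. by rewrite /qlij => ->. Qed.

(** * Left multiplication by the long cycle *)

Section LeftMulCycle.

Variables (n : nat) (m p0 : 'I_n).
Hypothesis mE : m = n.-1 :> nat.

(** The exponent shift records how far the maximal value, at
    [(x.2^-1)%g m], is from the reference position [p0]. *)
Definition qlo (x : qlperm n) : qlperm n :=
  ((x.1 + qlij ((x.2^-1)%g m) p0)%R, perm_o n \c x.2).

Definition qlo_inv (x : qlperm n) : qlperm n :=
  let v := ((perm_o n)^-1)%g \c x.2 in
  ((x.1 - qlij ((v^-1)%g m) p0)%R, v).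

Lemma qloK : cancel qlo qlo_inv.
Proof.
by case=> g v; rewrite /qlo /qlo_inv /= /perm_comp mulgK addrK.
Qed.

Lemma qlo_invK : cancel qlo_inv qlo.
Proof.
by case=> g v; rewrite /qlo /qlo_inv /= /perm_comp mulgKV subrK.
Qed.

Lemma qlo_at (g : qlexp n) (v : 'S_n) :
  (v^-1)%g m = p0 -> qlo (g, v) = (g, perm_o n \c v).
Proof. by move=> vm; rewrite /qlo /= vm qlij_id addr0. Qed.

(** Let [p] be the position of the maximal value before the swap of [i] and
    [j]. If [p] is neither of them, then length differences and shifts agree.
    If [p = i], a cover can only lower the length before the cycle acts and
    only raise it afterwards, and [perm_len_o] turns the drop [2 * (j - i) -
    1] into a rise by one; the exponent [qij i j] that the first cover gains
    is that lost by the shift when the maximum moves from [i] to [j]. If [p =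
    j], the two kinds of covers trade places in the other direction. *)
Lemma qlcover_o k (x y : qlperm n) :
  qlcover k (qlo x) (qlo y) <-> qlcover k x y.
Proof.
have step (i j : 'I_n) : i < j -> y.2 = x.2 \c tperm i j ->
    (perm_len (qlo y).2 = (perm_len (qlo x).2).+1 /\ (qlo y).1 = (qlo x).1) \/
    ((perm_len (qlo x).2).+1 = perm_len (qlo y).2 + 2 * (j - i) /\
       (qlo y).1 = ((qlo x).1 + qlexp_of (qij i j))%R) <->
    (perm_len y.2 = (perm_len x.2).+1 /\ y.1 = x.1) \/
    ((perm_len x.2).+1 = perm_len y.2 + 2 * (j - i) /\
       y.1 = (x.1 + qlexp_of (qij i j))%R).
  case: x y => [g v] [h v'] /= ij v'E; rewrite (qlexp_of_qij (ltnW ij)).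
  set p := (v^-1)%g m; have vp : v p = m by rewrite permKV.
  have v'p : (v'^-1)%g m = tperm i j p.
    by apply: (@perm_inj _ v'); rewrite permKV v'E perm_compE tpermK.
  have lv := perm_len_o (v := v) (p := p) (etrans (congr1 _ vp) mE).
  have lv' : perm_len (perm_o n \c v') + n.-1 =
      perm_len v' + 2 * tperm i j p.
    by apply: perm_len_o; rewrite -v'p permKV.
  have lt_max q : q != p -> v q < v p.
    move=> qp; have := ltn_ord (v q).
    have : v q <> v p :> nat.
      by move=> /val_inj/perm_inj/eqP; rewrite (negPf qp).
    by rewrite vp mE; lia.
  have oE := perm_oE_max (etrans (congr1 _ vp) mE : v p = n.-1 :> nat).
  rewrite v'p.
  have [pi|pi] := eqVneq p i; last have [pj|pj] := eqVneq p j.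
  - rewrite -pi tpermL in lv' *.
    have vji : perm_len v' < perm_len v.
      rewrite -[v in X in _ < X](perm_comp_tpermK v i j) -v'E.
      apply: perm_len_tperm => //; rewrite v'E !perm_compE tpermL tpermR -pi.
      by apply: lt_max; rewrite pi; apply: contraTneq ij => ->; rewrite ltnn.
    have oij : perm_len (perm_o n \c v) < perm_len (perm_o n \c v').
      rewrite v'E perm_compA; apply: perm_len_tperm => //.
      rewrite !oE pi eqxx; case: eqVneq ij => // ->; rewrite ltnn //.
    (* As v' is shorter than v and o v' longer than o v, each side has only one
       possible kind of cover. *)
    rewrite -(qlijD p j p0) addrA; split=> -[[l e]|[l e]].
    + by right; split; [lia|exact: addIr e].
    + lia.
    + lia.
    + by left; split; [lia|rewrite e].
  - rewrite -pj tpermR in lv' *.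
    have vij : perm_len v < perm_len v'.
      rewrite v'E; apply: perm_len_tperm => //; rewrite -pj.
      by apply: lt_max; rewrite eq_sym.
    have oji : perm_len (perm_o n \c v') < perm_len (perm_o n \c v).
      rewrite -[v in X in _ < X](perm_comp_tpermK v i j) -v'E perm_compA.
      apply: perm_len_tperm => //; rewrite v'E perm_compA.
      rewrite !(perm_compE (perm_o n \c v)) tpermL tpermR !oE -pj eqxx.
      by case: eqVneq pi => // ->; rewrite eqxx.
    rewrite -(qlijD i p p0); split=> -[[l e]|[l e]].
    + lia.
    + left; split; first lia.
      by apply: (addIr (qlij i p + qlij p p0)%R); rewrite e addrAC addrA.
    + right; split; first lia.
      by rewrite e addrA addrAC.
    + lia.
  - rewrite tpermD 1?eq_sym // in lv' *; split=> -[[l e]|[l e]].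
    + by left; split; [lia|exact: addIr e].
    + by right; split; [lia|apply: (addIr (qlij p p0)); rewrite e addrAC].
    + by left; split; [lia|rewrite e].
    + by right; split; [lia|rewrite e addrAC].
split=> -[i [j [ikj yx xy]]]; exists i, j.
all: have ij : i < j by case/andP: ikj; apply: leq_trans.
  have {}yx : y.2 = x.2 \c tperm i j.
    by move: yx; rewrite /qlo /= -perm_compA => /mulIg.
  by split=> //; apply/(step i j ij yx).
by split=> //; [rewrite /= yx perm_compA|apply/(step i j ij yx)].
Qed.

Lemma qlle_o k (x y : qlperm n) : qlle k x y -> qlle k (qlo x) (qlo y).
Proof. by apply: clos_homo => {x y} x y /qlcover_o. Qed.

Lemma qlle_o_inv k (x y : qlperm n) :
  qlle k x y -> qlle k (qlo_inv x) (qlo_inv y).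
Proof.
by apply: clos_homo => {x y} x y xy; apply/qlcover_o; rewrite !qlo_invK.
Qed.

End LeftMulCycle.

(** * Conjugation and left multiplication by the longest element *)

Definition qlexp_w0 n (g : qlexp n) : qlexp n := [ffun c => g (rev_ord c)].

Lemma qlexp_w0K n : involutive (@qlexp_w0 n).
Proof. by move=> g; apply/ffunP => c; rewrite !ffunE rev_ordK. Qed.

Lemma qlexp_w0D n (g h : qlexp n) :
  qlexp_w0 (g + h)%R = (qlexp_w0 g + qlexp_w0 h)%R.
Proof. by apply/ffunP => c; rewrite !ffunE. Qed.

Lemma qlexp_w0_of n (g : qexp n) : qlexp_w0 (qlexp_of g) = qlexp_of (qexp_w0 g).
Proof. by apply/ffunP => c; rewrite !ffunE. Qed.

Lemma qexp_w0_qij n (i j : 'I_n) :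
  qexp_w0 (qij i j) = qij (rev_ord j) (rev_ord i).
Proof.
apply/ffunP => c; rewrite !ffunE /=; have := ltn_ord c.
have := ltn_ord i; have := ltn_ord j; lia.
Qed.

Definition qlconj_w0 n (x : qlperm n) : qlperm n :=
  (qlexp_w0 x.1, perm_w0 n \c x.2 \c perm_w0 n).

Lemma qlconj_w0K n : involutive (@qlconj_w0 n).
Proof.
case=> g v; rewrite /qlconj_w0 /= qlexp_w0K.
by rewrite -(perm_compA (perm_w0 n) v) perm_w0_compK perm_comp_w0K.
Qed.

Lemma qlle_conj_w0 n k (x y : qlperm n) : k <= n -> qlle k x y ->
  qlle (n - k) (qlconj_w0 x) (qlconj_w0 y).
Proof.
move=> le_kn; apply: clos_homo => {x y} x y [i [j [ikj yx xy]]].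
exists (rev_ord j), (rev_ord i); split=> /=.
- have := ltn_ord i; have := ltn_ord j; lia.
- by rewrite yx -!perm_compA tperm_w0.
- rewrite !perm_len_w0_conj -qexp_w0_qij -qlexp_w0_of -qlexp_w0D.
  have -> : n - i.+1 - (n - j.+1) = j - i.
    have := ltn_ord i; have := ltn_ord j; lia.
  by case: xy => -[-> ->]; [left|right].
Qed.

Definition qlw0 n (c : qlexp n) (x : qlperm n) : qlperm n :=
  ((c - x.1)%R, perm_w0 n \c x.2).

Lemma qlw0K n c : involutive (@qlw0 n c).
Proof.
by case=> g v; rewrite /qlw0 /= perm_w0_compK opprB addrC subrK.
Qed.

(** Length changes sign up to a constant, so a swap that goes up by a cover goes
    down by a cover of the same kind; subtracting the exponent from [c] makes
    the gain of [qij i j] run the same way. *)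
Lemma qlle_w0 n k c (x y : qlperm n) :
  qlle k x y -> qlle k (qlw0 c y) (qlw0 c x).
Proof.
apply: clos_anti => {x y} x y [i [j [ikj yx xy]]].
exists i, j; split=> //=; first by rewrite yx -perm_compA perm_comp_tpermK.
have := perm_len_w0 x.2; have := perm_len_w0 y.2.
case: xy => -[l ->] ly lx; [left|right]; split=> //; try lia.
by rewrite opprD addrA subrK.
Qed.

(** * Intervals *)

Lemma qinterval_iso n k k' (f g : qlperm n -> qlperm n) (x y x' y' : qperm n) :
    cancel f g -> cancel g f ->
    (forall a b, qlle k a b -> qlle k' (f a) (f b)) ->
    (forall a b, qlle k' a b -> qlle k (g a) (g b)) ->
    f (qlperm_of x) = qlperm_of x' -> f (qlperm_of y) = qlperm_of y' ->
  rel_iso (between (@qle n k) x y) (@qle n k)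
    (between (@qle n k') x' y') (@qle n k').
Proof.
move=> fK gK fR gR fx fy; apply: rel_iso_trans (qinterval_ql k x y) _.
apply: rel_iso_trans _ (rel_iso_sym (qinterval_ql k' x' y')).
by rewrite -fx -fy; apply: between_iso.
Qed.

Lemma qinterval_anti n k k' (f g : qlperm n -> qlperm n) (x y x' y' : qperm n) :
    cancel f g -> cancel g f ->
    (forall a b, qlle k a b -> qlle k' (f b) (f a)) ->
    (forall a b, qlle k' a b -> qlle k (g b) (g a)) ->
    f (qlperm_of x) = qlperm_of y' -> f (qlperm_of y) = qlperm_of x' ->
  rel_iso (between (@qle n k) x y) (@qle n k)
    (between (@qle n k') x' y') (fun z t => qle k' t z).
Proof.
move=> fK gK fR gR fx fy; apply: rel_iso_trans (qinterval_ql k x y) _.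
apply: rel_iso_trans _
  (rel_iso_flip (rel_iso_sym (qinterval_ql k' x' y'))).
rewrite -fx -fy.
apply: (@rel_iso_eqr _ _ _ _
  (between (fun z t => qlle k' t z) (f (qlperm_of x)) (f (qlperm_of y)))).
  by move=> z; split=> -[].
by apply: between_iso fK gK fR _ => z t; apply: gR.
Qed.

Theorem corollary5p14 (n k : nat) (hn : 2 <= n) (hk : 1 <= k < n)
    (u w : 'S_n) (a : qexp n) :
  qlt k (qperm1 u) (a, w) ->
  exists b : qexp n,
    [/\ qlexp_of b = (qlexp_o (ltnW hn) u w + qlexp_of a)%R,
        qinterval k (qperm1 u) (a, w) \simeq
        qinterval k (qperm1 (perm_o n \c u)) (b, perm_o n \c w),
        qinterval k (qperm1 (perm_o n \c u)) (b, perm_o n \c w) \simeq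
        qinterval (n - k) (qperm1 (perm_w0 n \c u \c perm_w0 n))
                          (qexp_w0 a, perm_w0 n \c w \c perm_w0 n)
      & qinterval (n - k) (qperm1 (perm_w0 n \c u \c perm_w0 n))
                          (qexp_w0 a, perm_w0 n \c w \c perm_w0 n) \simeq
        op_poset (qinterval (n - k) (qperm1 (w \c perm_w0 n))
                                    (qexp_w0 a, u \c perm_w0 n))].
Proof.
case/andP: hk => _ /ltnW le_kn [uw _].
set m := ord_last (ltnW hn); have mE : m = n.-1 :> nat by rewrite /= subn1.
set f := qlo m ((u^-1)%g m).
have fu : f (qlperm_of (qperm1 u)) = qlperm_of (qperm1 (perm_o n \c u)).
  exact: qlo_at.
have /qlle_of[[b w'] fw _] :
    qlle k (qlperm_of (qperm1 (perm_o n \c u))) (f (qlperm_of (a, w))).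
  by rewrite -fu; apply: qlle_o => //; apply: qle_qlle.
have [bE w'E] : (qlexp_of a + qlexp_o (ltnW hn) u w)%R = qlexp_of b /\
    perm_o n \c w = w' by case: fw.
subst w'; exists b.
have iso_o : rel_iso (between (@qle n k) (qperm1 u) (a, w)) (@qle n k)
    (between (@qle n k) (qperm1 (perm_o n \c u)) (b, perm_o n \c w)) (@qle n k).
  apply: (qinterval_iso (qloK m _) (qlo_invK m _) _ _ fu fw).
    exact: qlle_o.
  exact: qlle_o_inv.
have iso_w0 : rel_iso (between (@qle n k) (qperm1 u) (a, w)) (@qle n k)
    (between (@qle n (n - k)) (qperm1 (perm_w0 n \c u \c perm_w0 n))
       (qexp_w0 a, perm_w0 n \c w \c perm_w0 n)) (@qle n (n - k)).
  apply: (qinterval_iso (@qlconj_w0K n) (@qlconj_w0K n)) => [x y|x y||].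
  - exact: qlle_conj_w0.
  - by rewrite -{2}(subKn le_kn); apply: qlle_conj_w0; rewrite leq_subr.
  - rewrite /qlconj_w0 /qlperm_of /= qlexp_w0_of; congr (qlexp_of _, _).
    by apply/ffunP => c; rewrite !ffunE.
  - by rewrite /qlconj_w0 /qlperm_of /= qlexp_w0_of.
split; first by rewrite -bE addrC.
- by apply: rel_iso_poset; exact: iso_o.
- by apply: rel_iso_poset; apply: rel_iso_trans (rel_iso_sym iso_o) iso_w0.
apply: rel_iso_poset.
pose c := qlexp_of (qexp_w0 a).
apply: (qinterval_anti (@qlw0K n c) (@qlw0K n c)) => [x y|x y||].
- exact: qlle_w0.
- exact: qlle_w0.
- rewrite /qlw0 /qlperm_of /= qlexp_of0 subr0.
  by rewrite -(perm_compA (perm_w0 n) u) perm_w0_compK.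
- rewrite /qlw0 /qlperm_of /= qlexp_of0 subrr.
  by rewrite -(perm_compA (perm_w0 n) w) perm_w0_compK.
Qed.
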